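(* For all positive integers $n,m$ with $m$ even, the one-sided error randomized query complexity and the exact quantum query complexity of $g_{n,m}$ satisfy $R_1(g_{n,m})=\tilde O(n+m)$ and $Q_E(g_{n,m})=\tilde O(n+m)$.
   Context: Let $n,m$ be positive integers with $m$ even, $M=[n]\times[m]$ (a grid of cells with $n$ rows and $m$ columns), $\tilde M = M\cup\{\bot\}$ (pointers to cells, $\bot$ is the null pointer). Let $T$ be the following fixed binary tree with $m$ leaves and $m-1$ internal nodes: if $m=2^k$, $T$ is the complete binary tree with $2^k$ leaves; if $2^k<m<2^{k+1}$, take the complete binary tree with $2^k$ leaves and add a pair of children to each of its $m-2^k$ leftmost leaves. Outgoing arcs of internal nodes are labeled 'left' and 'right', leaves are labeled $1,\dots,m$ from left to right, and $T(j)$ is the sequence of 'left'/'right' labels on the root-to-leaf-$j$ path. The input alphabet is $\Sigma=\{0,1\}\times\tilde M\times\tilde M\times\tilde M$; for $v\in\Sigma$ its components are $\mathrm{val}(v),\mathrm{lpoint}(v),\mathrm{rpoint}(v),\mathrm{bpoint}(v)$. The function $g_{n,m}\colon\Sigma^M\to\{0,1\}$ is defined by $g_{n,m}(x)=1$ iff: (1) there is exactly one column $b\in[m]$ with $\mathrm{val}(x_{i,b})=1$ for all $i\in[n]$ (the marked column); (2) in column $b$ there is a unique cell $a$ with $x_a\ne(1,\bot,\bot,\bot)$ (the special element); (3) for each column $j\in[m]\setminus\{b\}$, the path starting at $a$ and following $\mathrm{lpoint},\mathrm{rpoint}$ as specified by $T(j)$ exists (no pointer on it is $\bot$) and ends in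 a cell $\ell_j$ in column $j$ with $\mathrm{val}(x_{\ell_j})=0$; (4') the set $G=\{j\in[m]\setminus\{b\} : \mathrm{bpoint}(x_{\ell_j})=a\}$ has size exactly $m/2$. A query asks for the value $x_c\in\Sigma$ of one cell. $R_1(f)$ is the minimum worst-case expected number of queries of a randomized decision tree that rejects every $x$ with $f(x)=0$ with probability $1$ and accepts every $x$ with $f(x)=1$ with probability at least $1/2$. $Q_E(f)$ is the minimum number of queries of a quantum query algorithm (queries $O_x|c,p\rangle|w\rangle=|c,p+x_c \bmod|\Sigma|\rangle|w\rangle$, identifying $\Sigma$ with $[|\Sigma|]$) that outputs $f(x)$ with probability $1$ on every input. $\tilde O$ hides factors polylogarithmic in $n,m$. *)

(* Defs.v *)
From HB Require Import structures.
From mathcomp Require Import all_boot all_order all_algebra.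
From mathcomp Require Import reals.
From mathcomp Require Import complex.
Set Implicit Arguments. Unset Strict Implicit. Unset Printing Implicit Defensive.
Import Order.TTheory GRing.Theory Num.Theory.
Local Open Scope ring_scope.

(* Rows and columns are 0-indexed: row i : 'I_n, column j : 'I_m.     *)
(* Pointers in ~M = M u {bot} are [option cell], with None = bot.     *)
Definition cell (n m : nat) : finType := ('I_n * 'I_m)%type.
Definition ptr (n m : nat) : finType := option (cell n m).
Definition Sigma (n m : nat) : finType :=
  (bool * ptr n m * ptr n m * ptr n m)%type.

Definition sval {n m} (v : Sigma n m) : bool := v.1.1.1.
Definition lpoint {n m} (v : Sigma n m) : ptr n m := v.1.1.2.
Definition rpoint {n m} (v : Sigma n m) : ptr n m := v.1.2.
Definition bpoint {n m} (v : Sigma n m) : ptr n m := v.2.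

Notation ginput n m := {ffun cell n m -> Sigma n m}.

Inductive btree := BLeaf | BNode of btree & btree.

Fixpoint complete_tree (k : nat) : btree :=
  if k is k'.+1 then BNode (complete_tree k') (complete_tree k') else BLeaf.

Fixpoint expand_leaves (t : btree) (d : nat) : btree * nat :=
  match t with
  | BLeaf => if d is d'.+1 then (BNode BLeaf BLeaf, d') else (BLeaf, 0)
  | BNode l r =>
      let (l', d1) := expand_leaves l d in
      let (r', d2) := expand_leaves r d1 in
      (BNode l' r', d2)
  end.

Definition treeT (m : nat) : btree :=
  (expand_leaves (complete_tree (trunc_log 2 m)) (m - 2 ^ trunc_log 2 m)%N).1.

Fixpoint leaf_paths (t : btree) : seq (seq bool) :=
  match t with
  | BLeaf => [:: [::]]
  | BNode l r => map (cons false) (leaf_paths l) ++ map (cons true) (leaf_paths r)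
  end.

(* T(j) for column j (0-indexed column j is leaf number j+1) *)
Definition Tpath (m : nat) (j : nat) : seq bool := nth [::] (leaf_paths (treeT m)) j.

Fixpoint follow {n m} (x : ginput n m) (p : seq bool) (c : cell n m)
  : option (cell n m) :=
  match p with
  | [::] => Some c
  | b :: p' =>
      match (if b then rpoint (x c) else lpoint (x c)) with
      | None => None
      | Some c' => follow x p' c'
      end
  end.

Definition ell {n m} (x : ginput n m) (a : cell n m) (j : 'I_m) : option (cell n m) :=
  follow x (Tpath m j) a.

Definition marked_col {n m} (x : ginput n m) (b : 'I_m) : bool :=
  [forall i : 'I_n, sval (x (i, b))].

Definition blank {n m} : Sigma n m := (true, None, None, None).

Definition path_ok {n m} (x : ginput n m) (a : cell n m) (j : 'I_m) : bool :=
  match ell x a j with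
  | Some l => (l.2 == j) && ~~ sval (x l)
  | None => false
  end.

Definition Gset {n m} (x : ginput n m) (a : cell n m) (b : 'I_m) : {set 'I_m} :=
  [set j : 'I_m | (j != b) &&
     match ell x a j with Some l => bpoint (x l) == Some a | None => false end].

Definition g (n m : nat) (x : ginput n m) : bool :=
  [exists b : 'I_m, exists a : cell n m,
    [&&
        [forall b' : 'I_m, marked_col x b' == (b' == b)],
        a.2 == b,
        [forall a' : cell n m, ((a'.2 == b) && (x a' != blank)) == (a' == a)],
        [forall j : 'I_m, (j != b) ==> path_ok x a j]
      &
        #|Gset x a b| == (m %/ 2)%N]].
Arguments g : clear implicits.

Inductive dtree (I : finType) (A : Type) :=
  | DLeaf of bool
  | DQuery of I & (A -> dtree I A).
Arguments DLeaf {I A}.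
Arguments DQuery {I A}.

Fixpoint dt_eval {I : finType} {A : Type} (t : dtree I A) (x : I -> A) : bool :=
  match t with
  | DLeaf b => b
  | DQuery i k => dt_eval (k (x i)) x
  end.

Fixpoint dt_cost {I : finType} {A : Type} (t : dtree I A) (x : I -> A) : nat :=
  match t with
  | DLeaf _ => 0
  | DQuery i k => (dt_cost (k (x i)) x).+1
  end.

(* a randomized decision tree = finitely supported probability
   distribution over deterministic decision trees *)
Definition rdtree (R : realType) (I : finType) (A : Type) := seq (R * dtree I A).

Definition is_distr {R : realType} {I : finType} {A : Type} (D : rdtree R I A) : Prop :=
  all (fun p => 0 <= p.1) D /\ \sum_(p <- D) p.1 = 1.

Definition acc_prob {R : realType} {I : finType} {A : Type}
  (D : rdtree R I A) (x : I -> A) : R :=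
  \sum_(p <- D) p.1 * (dt_eval p.2 x)%:R.

Definition exp_cost {R : realType} {I : finType} {A : Type}
  (D : rdtree R I A) (x : I -> A) : R :=
  \sum_(p <- D) p.1 * (dt_cost p.2 x)%:R.

Definition R1_le {R : realType} {I A : finType} (f : {ffun I -> A} -> bool) (q : R) : Prop :=
  exists D : rdtree R I A, is_distr D /\
    forall x : {ffun I -> A},
      (f x = false -> acc_prob D x = 0) /\
      (f x = true -> 2^-1 <= acc_prob D x) /\
      exp_cost D x <= q.

(* Basis states |c, p>|w> with c : I (query index), p : [|Sigma|]     *)
(* (Sigma identified with 'I_#|A| via enum_rank), w : 'I_d workspace. *)
Definition qbasis (I A : finType) (d : nat) : finType := (I * 'I_#|A| * 'I_d)%type.

Definition addord (N : nat) (p q : 'I_N) : 'I_N :=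
  Ordinal (ltn_pmod (p + q)%N (leq_ltn_trans (leq0n p) (ltn_ord p))).

Definition qshift {I A : finType} {d : nat} (x : {ffun I -> A}) (s : qbasis I A d)
  : qbasis I A d :=
  (s.1.1, addord s.1.2 (enum_rank (x s.1.1)), s.2).

Definition oracle_mx (R : realType) {I A : finType} (d : nat) (x : {ffun I -> A})
  : 'M[R[i]]_#|qbasis I A d| :=
  \matrix_(r, c) (enum_val r == qshift x (enum_val c))%:R.

Definition conj_tr (R : realType) (N : nat) (U : 'M[R[i]]_N) : 'M[R[i]]_N :=
  (map_mx (@conjc R) U)^T.

Definition unitary_mx (R : realType) (N : nat) (U : 'M[R[i]]_N) : bool :=
  U *m conj_tr U == 1%:M.

Definition basis_vec (R : realType) {B : finType} (b : B) : 'cV[R[i]]_#|B| :=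
  \col_r (r == enum_rank b)%:R.

Definition final_state (R : realType) {I A : finType} (d : nat)
  (b0 : qbasis I A d) (U0 : 'M[R[i]]_#|qbasis I A d|)
  (Us : seq 'M[R[i]]_#|qbasis I A d|) (x : {ffun I -> A}) : 'cV[R[i]]_#|qbasis I A d| :=
  foldl (fun s U => U *m (oracle_mx R d x *m s)) (U0 *m basis_vec R b0) Us.

Definition out_prob (R : realType) {B : finType} (psi : 'cV[R[i]]_#|B|)
  (out : B -> bool) (b : bool) : R[i] :=
  \sum_(r : 'I_#|B| | out (enum_val r) == b) psi r 0 * conjc (psi r 0).

Definition QE_le (R : realType) {I A : finType} (f : {ffun I -> A} -> bool) (T : nat) : Prop :=
  exists (d : nat) (b0 : qbasis I A d) (U0 : 'M[R[i]]_#|qbasis I A d|)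
         (Us : seq 'M[R[i]]_#|qbasis I A d|) (out : qbasis I A d -> bool),
    size Us = T /\ all (@unitary_mx R _) (U0 :: Us) /\
    forall x : {ffun I -> A}, out_prob (final_state b0 U0 Us x) out (f x) = 1.

Definition ot_bound (C k n m : nat) : nat :=
  (C * (n + m) * (trunc_log 2 (n + m)).+1 ^ k)%N.

(* Main.v *)
Require Import Defs.
From HB Require Import structures.
From mathcomp Require Import all_boot all_order all_algebra all_fingroup.
From mathcomp Require Import reals.
From mathcomp Require Import complex.
From mathcomp Require Import zify ring.
Set Implicit Arguments. Unset Strict Implicit. Unset Printing Implicit Defensive.
Import Order.TTheory GRing.Theory Num.Theory.
Local Open Scope ring_scope.

(** For each column [j] a deterministic decision tree with Otilde(n + m) queries accepts iff
    [g x] = 1 and [j] lies in [G].  If [j] is in [G], then the special element is among the at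
    most [n] back pointers of column [j]; a knock-out tournament with O(log m) queries per round
    leaves one candidate, which is then verified exhaustively.  So either no column accepts, or
    exactly half of the columns do.  A uniformly random column gives the one-sided randomized
    bound; Deutsch-Jozsa on the columns, with the tree computed and uncomputed coherently, gives
    the exact quantum bound. *)

(** * Query programs with results of arbitrary type *)

Section Programs.
Local Open Scope nat_scope.
Context {I : finType} {A : Type}.

(** Decision trees with results of any type, so that subroutines compose by [bind] and their costs
    add up; [dtree_of] returns to Boolean trees. *)
Inductive prog (X : Type) :=
  | Ret of X
  | Ask of I & (A -> prog X).
Arguments Ret {X}.
Arguments Ask {X}.

Fixpoint bind {X Y : Type} (p : prog X) (k : X -> prog Y) : prog Y :=
  match p with
  | Ret v => k v
  | Ask i q => Ask i (fun a => bind (q a) k)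
  end.

Fixpoint peval {X : Type} (p : prog X) (x : I -> A) : X :=
  match p with
  | Ret v => v
  | Ask i q => peval (q (x i)) x
  end.

Fixpoint pcost {X : Type} (p : prog X) (x : I -> A) : nat :=
  match p with
  | Ret _ => 0
  | Ask i q => (pcost (q (x i)) x).+1
  end.

Fixpoint dtree_of (p : prog bool) : dtree I A :=
  match p with
  | Ret b => DLeaf b
  | Ask i q => DQuery i (fun a => dtree_of (q a))
  end.

Lemma dt_eval_of p x : dt_eval (dtree_of p) x = peval p x.
Proof. by elim: p => //= i q IH; rewrite IH. Qed.

Lemma dt_cost_of p x : dt_cost (dtree_of p) x = pcost p x.
Proof. by elim: p => //= i q IH; rewrite IH. Qed.

Lemma peval_bind X Y (p : prog X) (k : X -> prog Y) x :
  peval (bind p k) x = peval (k (peval p x)) x.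
Proof. by elim: p => //= i q IH; rewrite IH. Qed.

Lemma pcost_bind X Y (p : prog X) (k : X -> prog Y) x :
  pcost (bind p k) x = pcost p x + pcost (k (peval p x)) x.
Proof. by elim: p => //= i q IH; rewrite IH. Qed.

Definition ask (i : I) : prog A := Ask i Ret.

Fixpoint mapM {X Y : Type} (f : X -> prog Y) (s : seq X) : prog (seq Y) :=
  if s is v :: s' then bind (f v) (fun w => bind (mapM f s') (fun t => Ret (w :: t)))
  else Ret [::].

Lemma peval_mapM X Y (f : X -> prog Y) s x :
  peval (mapM f s) x = [seq peval (f v) x | v <- s].
Proof. by elim: s => //= v s IH; rewrite !peval_bind /= IH. Qed.

Lemma pcost_mapM X Y (f : X -> prog Y) s x c :
  (forall v, pcost (f v) x <= c) -> pcost (mapM f s) x <= size s * c.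
Proof.
move=> fc; elim: s => //= v s IH.
by rewrite !pcost_bind /= addn0 mulSn leq_add.
Qed.

Fixpoint foldM {X S : Type} (f : S -> X -> prog S) (s0 : S) (s : seq X) : prog S :=
  if s is v :: s' then bind (f s0 v) (fun s1 => foldM f s1 s') else Ret s0.

Lemma pcost_foldM X S (f : S -> X -> prog S) s0 s x c :
  (forall u v, pcost (f u v) x <= c) -> pcost (foldM f s0 s) x <= size s * c.
Proof.
move=> fc; elim: s s0 => //= v s IH s0.
by rewrite pcost_bind mulSn leq_add.
Qed.

End Programs.
Arguments prog : clear implicits.
Arguments Ret {I A X}.
Arguments Ask {I A X}.

(** * Classical column test *)

Section TreeDepth.
Local Open Scope nat_scope.

(** Every leaf is split at most once. The induction is over all [d], as the right subtree starts
    from the count that the left one leaves. *)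
Lemma expand_leaves_depth k d :
  all (fun p => size p <= k.+1) (leaf_paths (expand_leaves (complete_tree k) d).1).
Proof.
elim: k d => [|k IH] d /=; first by case: d.
case: (expand_leaves _ d) (IH d) => l d1 /= IHl.
case: (expand_leaves _ d1) (IH d1) => r d2 /= IHr.
rewrite all_cat !all_map.
by apply/andP; split; [exact: IHl | exact: IHr].
Qed.

Lemma size_Tpath m j : size (Tpath m j) <= (trunc_log 2 m).+1.
Proof.
rewrite /Tpath /treeT.
set s := leaf_paths _.
(* Beyond the leaves [nth] returns the empty path, which meets the bound. *)
have [jlt|jge] := ltnP j (size s); last by rewrite nth_default.
exact: (allP (expand_leaves_depth _ _)) (mem_nth _ jlt).
Qed.

End TreeDepth.

(** * Special cells, tournament and column test *)

Section Columns.
Local Open Scope nat_scope.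
Context {n m : nat}.
Notation cell := (cell n m).
Notation Sigma := (Sigma n m).
Notation prog := (prog cell Sigma).
Implicit Types (x : ginput n m) (a c : cell) (j : 'I_m).

Definition points_back x a j : bool :=
  if ell x a j is Some l then bpoint (x l) == Some a else false.

Lemma in_Gset x a b j : (j \in Gset x a b) = (j != b) && points_back x a j.
Proof. by rewrite inE. Qed.

Definition special x a : bool :=
  [&& [forall i, Defs.sval (x (i, a.2)) && ((x (i, a.2) != blank) == (i == a.1))],
      [forall j, (j != a.2) ==> path_ok x a j]
    & #|Gset x a a.2| == m %/ 2].

Lemma special_marked x a : special x a -> marked_col x a.2.
Proof.
by case/and3P=> /forallP H _ _; apply/forallP => i; case/andP: (H i).
Qed.

Lemma special_blank x a i : special x a -> (x (i, a.2) != blank) = (i == a.1).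
Proof. by case/and3P=> /forallP H _ _; case/andP: (H i) => _ /eqP. Qed.

Lemma special_path x a j : special x a -> j != a.2 -> path_ok x a j.
Proof. by case/and3P=> _ /forallP/(_ j)/implyP H _ /H. Qed.

Lemma path_ok_unmarked x a j : path_ok x a j -> ~~ marked_col x j.
Proof.
rewrite /path_ok; case: (ell x a j) => // -[i j'] /= /andP[/eqP -> v0].
by apply/forallPn; exists i.
Qed.

Lemma cell_rowE a i j : ((i, j) == a) = (i == a.1) && (j == a.2).
Proof. by case: a => i' j'; rewrite xpair_eqE. Qed.

(** Each path into another column ends at a cell of value 0, which makes [a.2] the only marked
    column; so the quantifier over columns collapses onto the cell. *)
Lemma gE x : g n m x = [exists a, special x a].
Proof.
apply/existsP/existsP => [[b /existsP[a]]|[a sa]].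
  case/and5P=> /forallP Hm /eqP ab /forallP Hu Hp HG.
  exists a; rewrite -ab in Hm Hu Hp HG; apply/and3P; split=> //.
  apply/forallP => i; apply/andP; split.
    by move: (Hm a.2); rewrite eqxx eqb_id => /forallP.
  by move: (Hu (i, a.2)); rewrite cell_rowE eqxx andbT.
exists a.2; apply/existsP; exists a; apply/and5P; split=> //; last 1 first.
- by case/and3P: sa.
- apply/forallP => b'; apply/eqP; case: eqVneq => [->|ne].
    exact: special_marked.
  exact: negbTE (path_ok_unmarked (special_path sa ne)).
- apply/forallP => -[i j] /=; rewrite cell_rowE; have [->|ne] := eqVneq j a.2; last by rewrite andbF.
  by rewrite special_blank //= andbT eqxx.
- by case/and3P: sa.
Qed.

(** The path of one special cell into the column of another would show that column unmarked. So both
    share a column, and there the non-blank cell is unique. *)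
Lemma special_uniq x a c : special x a -> special x c -> a = c.
Proof.
move=> sa sc; have ac2 : c.2 = a.2.
  apply/eqP/negPn/negP => /(special_path sa)/path_ok_unmarked.
  by rewrite special_marked.
have := special_blank a.1 sc; rewrite ac2 special_blank // eqxx.
by case: a c ac2 {sa sc} => [? ?] [? ?] /= -> /esym/eqP ->.
Qed.

Fixpoint walk (p : seq bool) c : prog (option cell) :=
  if p is b :: p' then
    Ask c (fun v => if (if b then rpoint v else lpoint v) is Some c' then walk p' c'
                    else Ret None)
  else Ret (Some c).

Lemma peval_walk x p c : peval (walk p c) x = follow x p c.
Proof. by elim: p c => //= b p IH c; case: (if b then _ else _). Qed.

Lemma pcost_walk x p c : pcost (walk p c) x <= size p.
Proof. by elim: p c => //= b p IH c; case: (if b then _ else _). Qed.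

(** One walk serves both tests, since validity and back pointer are read off from the same final
    cell. *)
Definition probe a j : prog (bool * bool) :=
  bind (walk (Tpath m j) a) (fun ol =>
    if ol is Some l then
      Ask l (fun v => Ret ((l.2 == j) && ~~ Defs.sval v, bpoint v == Some a))
    else Ret (false, false)).

Lemma peval_probe x a j : peval (probe a j) x = (path_ok x a j, points_back x a j).
Proof.
rewrite peval_bind peval_walk /path_ok /points_back /ell.
by case: follow.
Qed.

Lemma pcost_probe x a j : pcost (probe a j) x <= trunc_log 2 m + 2.
Proof.
(* The walk takes at most [trunc_log 2 m + 1] queries; one more reads the final cell. *)
rewrite pcost_bind addn2 -addn1 leq_add //.
  exact: leq_trans (pcost_walk _ _ _) (size_Tpath _ _).
by case: (peval _ _).
Qed.

(** Membership in [G] is returned for all columns along with the verdict, so that reading off one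
    column costs no further query. *)
Definition verify a : prog (bool * seq bool) :=
  bind (mapM (fun i => bind (ask (i, a.2)) (fun v =>
           Ret (Defs.sval v && ((v != blank) == (i == a.1))))) (enum 'I_n)) (fun rows =>
  bind (mapM (probe a) (enum 'I_m)) (fun cols =>
    let ok := [seq (j == a.2) || c.1 | '(j, c) <- zip (enum 'I_m) cols] in
    let back := [seq (j != a.2) && c.2 | '(j, c) <- zip (enum 'I_m) cols] in
    Ret ([&& all id rows, all id ok & count id back == m %/ 2], back))).

Lemma peval_verify x a :
  peval (verify a) x = (special x a, [seq j \in Gset x a a.2 | j <- enum 'I_m]).
Proof.
rewrite /verify !peval_bind /= !peval_mapM /=.
have -> : zip (enum 'I_m) [seq peval (probe a v) x | v <- enum 'I_m]
  = [seq (j, (path_ok x a j, points_back x a j)) | j <- enum 'I_m].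
  by elim: (enum 'I_m) => //= j s ->; rewrite peval_probe.
rewrite -!map_comp /= (eq_map (in_Gset x a a.2)); congr (_, _).
rewrite /special; congr [&& _, _ & _].
- by rewrite all_map; apply/allP/forallP => [H i|H i _]; [apply: (H i); rewrite -enumT mem_enum | exact: H].
- rewrite all_map; apply/allP/forallP => [H j|H j _]; rewrite /= ?implyNb.
    by apply: (H j); rewrite -enumT mem_enum.
  by have:= H j; rewrite implyNb.
- rewrite count_map cardE /enum_mem size_filter -enumT.
  by congr (_ == _); apply: eq_count => j /=; rewrite in_Gset.
Qed.

Lemma pcost_verify x a : pcost (verify a) x <= n + m * (trunc_log 2 m + 2).
Proof.
rewrite /verify !pcost_bind /= addn0 leq_add //.
  by apply: leq_trans (@pcost_mapM _ _ _ _ _ _ _ 1 _) _; rewrite // size_enum_ord muln1.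
by apply: leq_trans (pcost_mapM _ (pcost_probe x a)) _; rewrite size_enum_ord.
Qed.

(* A special cell of one column certifies, by its path into any other column, that the latter
   is unmarked; so one path probe rules out one of two cells from different columns. *)
Definition duel a c : prog cell :=
  if a.2 == c.2 then Ask a (fun v => Ret (if v != blank then a else c))
  else bind (probe a c.2) (fun r => Ret (if r.1 then a else c)).

Lemma peval_duel x a c d :
  special x d -> d \in [:: a; c] -> peval (duel a c) x = d.
Proof.
move=> sd; rewrite !inE /duel => /orP[]/eqP dE; subst d; case: eqVneq => ac /=.
- by case: a {ac} sd => i j sd; rewrite (special_blank i sd) eqxx.
- by rewrite peval_bind peval_probe /= special_path // eq_sym.
(* Same column with [c] special: [a] is non-blank only if it equals [c], so either answer yields
   [c]. *)
- case: a ac => i j /= ->; rewrite special_blank //.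
  by case: eqVneq => // ->; case: c {sd}.
- rewrite peval_bind peval_probe /=; case: ifP => // /path_ok_unmarked.
  by rewrite special_marked.
Qed.

Lemma pcost_duel x a c : pcost (duel a c) x <= trunc_log 2 m + 2.
Proof.
rewrite /duel; case: ifP => _ /=; first by rewrite addn2.
by rewrite pcost_bind /= addn0 pcost_probe.
Qed.

(** Invariant: the special cell is either the current winner or still to come. *)
Lemma peval_tournament x c s d :
  special x d -> d \in c :: s -> peval (foldM duel c s) x = d.
Proof.
move=> sd; elim: s c => [|c' s IH] c /=; first by rewrite inE => /eqP.
rewrite peval_bind !inE orbA => /orP[dcc|ds].
  by rewrite (peval_duel sd) ?inE //; apply: IH; rewrite inE eqxx.
by apply: IH; rewrite inE ds orbT.
Qed.

Definition column_test j : prog bool :=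
  bind (mapM (fun i => ask (i, j)) (enum 'I_n)) (fun col =>
    if pmap bpoint col is c :: s then
      bind (foldM duel c s) (fun a =>
      bind (verify a) (fun r => Ret (r.1 && nth false r.2 j)))
    else Ret false).

Lemma peval_column_test x j :
  peval (column_test j) x = [exists a, special x a && (j \in Gset x a a.2)].
Proof.
have nthG a : nth false [seq k \in Gset x a a.2 | k <- enum 'I_m] j = (j \in Gset x a a.2).
  by rewrite (nth_map j) ?nth_ord_enum // size_enum_ord.
rewrite /column_test peval_bind peval_mapM /=.
set col := [seq _ | i <- _].
have [[a /andP[sa aG]]|none] := existsP; last first.
  case: (pmap bpoint col) => [|c s] //=.
  rewrite 2!peval_bind peval_verify /= nthG.
  (* Verification is exhaustive, so any accepted candidate is itself a witness, however the duels
     went. *)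
  by apply/negbTE/negP => H; apply: none; exists (peval (foldM duel c s) x).
(* The path from [a] ends in column [j] at a cell pointing back to [a], so [a] is among the
   candidates. *)
have acol : a \in pmap bpoint col.
  move: aG (special_path (j := j) sa).
  rewrite in_Gset /path_ok /points_back => /andP[ja].
  case: (ell x a j) => // -[i j'] /eqP bE /(_ ja) /andP[/= /eqP jE _]; subst j'.
  rewrite mem_pmap -bE; apply: map_f; apply/mapP.
  by exists i; rewrite ?mem_enum.
case: (pmap bpoint col) acol => // c s acs.
by rewrite 2!peval_bind peval_verify /= (peval_tournament sa acs) nthG sa.
Qed.

Lemma pcost_column_test x j :
  pcost (column_test j) x <= 4 * (n + m) * (trunc_log 2 (n + m)).+1.
Proof.
have logm : trunc_log 2 m <= trunc_log 2 (n + m) by apply: leq_trunc_log; exact: leq_addl.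
rewrite /column_test pcost_bind peval_mapM.
set col := [seq _ | i <- _].
have ccol : pcost (mapM (fun i => ask (i, j)) (enum 'I_n)) x <= n.
  by rewrite -[leqRHS]muln1 -[X in X * 1](size_enum_ord n); apply: pcost_mapM.
have szcol : size (pmap bpoint col) <= n.
  by rewrite size_pmap (leq_trans (count_size _ _)) // /col size_map size_enum_ord.
move: logm ccol; set L := trunc_log 2 (n + m); set l := trunc_log 2 m => logm ccol.
(* The three costs are those of reading the column, the duels and the verification; together they
   are at most [(n + m) * (l + 4)]. *)
have bound p q r : p <= n -> q <= n * (l + 2) -> r <= n + m * (l + 2) ->
    p + (q + r) <= 4 * (n + m) * L.+1.
  by rewrite mulnS => pn qn rn; nia.
case: (pmap bpoint col) szcol => [|c s] szcol; first exact: (bound _ 0 0).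
rewrite 2!pcost_bind addn0; apply: bound => //; last exact: pcost_verify.
apply: leq_trans (pcost_foldM _ _ (pcost_duel x)) _.
by rewrite leq_mul2r orbC ltnW.
Qed.

Lemma column_test_reject x j : g n m x = false -> dt_eval (dtree_of (column_test j)) x = false.
Proof.
rewrite gE dt_eval_of peval_column_test => ng.
by apply: contraFF ng => /existsP[a /andP[sa _]]; apply/existsP; exists a.
Qed.

(** By uniqueness of the special cell the accepting columns form exactly its set [G]; evenness of
    [m] turns [m %/ 2] doubled back into [m]. *)
Lemma column_test_balanced x : ~~ odd m -> g n m x ->
  (#|[set j | dt_eval (dtree_of (column_test j)) x]|.*2 = m)%N.
Proof.
rewrite gE => em /existsP[a sa].
rewrite (_ : [set j | _] = Gset x a a.2); last first.
  apply/setP => j; rewrite inE dt_eval_of peval_column_test.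
  apply/existsP/idP => [[c /andP[sc]]|aG]; last by exists a; rewrite sa.
  by rewrite (special_uniq sc sa).
by case/and3P: sa => _ _ /eqP ->; rewrite divn2 halfK (negbTE em) subn0.
Qed.

End Columns.

(** A uniformly chosen tree accepts with probability 0 or exactly 1/2, and its expected cost is an
    average of costs bounded by [T]. *)
Lemma R1_le_uniform (R : realType) (I A J : finType) (f : {ffun I -> A} -> bool)
    (D : J -> dtree I A) (T : nat) :
  (0 < #|J|)%N ->
  (forall x j, f x = false -> dt_eval (D j) x = false) ->
  (forall x : {ffun I -> A}, f x -> (#|[set j | dt_eval (D j) x]|.*2 = #|J|)%N) ->
  (forall (x : {ffun I -> A}) j, (dt_cost (D j) x <= T)%N) ->
  R1_le f (T%:R : R).
Proof.
move=> J0 rej bal cost; set w : R := #|J|%:R^-1.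
have J0R : 0 < #|J|%:R :> R by rewrite ltr0n.
have w0 : 0 <= w by rewrite invr_ge0 ltW.
have sumw (F : R * dtree I A -> R) :
    \sum_(p <- [seq (w, D j) | j <- enum J]) F p = \sum_j F (w, D j).
  by rewrite big_map big_enum.
exists [seq (w, D j) | j <- enum J]; split.
  split; first by rewrite all_map; apply/allP.
  by rewrite sumw sumr_const -mulr_natr mulVf ?gt_eqF.
move=> x; rewrite /acc_prob /exp_cost !sumw /= -!mulr_sumr; split; [|split].
- by move=> fx; rewrite big1 ?mulr0 // => j _; rewrite rej.
- move=> fx; rewrite -natr_sum.
  have -> : (\sum_(j in J) dt_eval (D j) x = #|[set j | dt_eval (D j) x]|)%N.
    by rewrite -sum1dep_card [RHS]big_mkcond /=; apply: eq_bigr => j _; case: dt_eval.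
  have Jn0 : #|J|%:R != 0 :> R by rewrite gt_eqF.
  (* With k accepting trees the weight becomes 1/(2k), and k is nonzero because [#|J|] is. *)
  rewrite /w -(bal x fx) -mul2n natrM in Jn0 *.
  by move: Jn0; rewrite mulf_eq0 negb_or => /andP[_ k0]; rewrite invfM mulfVK.
- rewrite -natr_sum mulrC ler_pdivrMr // -natrM ler_nat.
  apply: leq_trans (leq_sum _ (fun j _ => cost x j)) _.
  by rewrite sum_nat_const mulnC.
Qed.

(** * Exact quantum algorithm *)

Section Dagger.
Context {R : realType}.
Notation C := R[i].

(** The rectangular form of [conj_tr]: inner products of column vectors become 1-by-1 matrices. *)
Definition dag p q (M : 'M[C]_(p, q)) : 'M[C]_(q, p) := (map_mx (@conjc R) M)^T.

Lemma dagM p q r (M : 'M[C]_(p, q)) (N : 'M_(q, r)) : dag (M *m N) = dag N *m dag M.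
Proof. by rewrite /dag map_mxM trmx_mul. Qed.

Lemma dagK p q : cancel (@dag p q) (@dag q p).
Proof. by move=> M; apply/matrixP => i j; rewrite !mxE conjcK. Qed.

Lemma dag1 p : dag 1%:M = 1%:M :> 'M_p.
Proof. by rewrite /dag map_mx1 trmx1. Qed.

Lemma dagB p q (M N : 'M[C]_(p, q)) : dag (M - N) = dag M - dag N.
Proof. by rewrite /dag map_mxB linearB. Qed.

Lemma dagZ p q a (M : 'M[C]_(p, q)) : dag (a *: M) = conjc a *: dag M.
Proof. by rewrite /dag map_mxZ linearZ. Qed.

Lemma unitaryP p (U : 'M[C]_p) : reflect (U *m dag U = 1%:M) (unitary_mx U).
Proof. exact: eqP. Qed.

Lemma unitary_dagl p (U : 'M[C]_p) : unitary_mx U -> dag U *m U = 1%:M.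
Proof. by move/unitaryP/mulmx1C. Qed.

Lemma unitary_dag p (U : 'M[C]_p) : unitary_mx U -> unitary_mx (dag U).
Proof. by move=> UU; apply/unitaryP; rewrite dagK unitary_dagl. Qed.

Lemma unitary_mul p (U V : 'M[C]_p) :
  unitary_mx U -> unitary_mx V -> unitary_mx (U *m V).
Proof.
move=> /unitaryP UU /unitaryP VV; apply/unitaryP.
by rewrite dagM mulmxA -(mulmxA U) VV mulmx1.
Qed.

(* Householder reflection along [e - u]. *)
Lemma unitary_transport p (e u : 'cV[C]_p) (s : C) :
  dag e *m e = 1%:M -> dag u *m u = 1%:M -> dag e *m u = s%:M -> dag u *m e = s%:M ->
  conjc s = s -> s != 1 ->
  exists2 V, unitary_mx V & V *m e = u.
Proof.
move=> ee uu eu ue sr s1; set v := e - u; set a := (1 - s)^-1.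
have s0 : 1 - s != 0 by rewrite subr_eq0 eq_sym.
have ve : dag v *m e = (1 - s)%:M by rewrite /v dagB mulmxBl ee ue raddfB.
have vv : dag v *m v = (2 * (1 - s))%:M.
  rewrite {2}/v mulmxBr ve /v dagB mulmxBl eu uu -!raddfB /=.
  by congr (_%:M); ring.
have ar : conjc a = a by rewrite /a fmorphV rmorphB rmorph1 /= sr.
(* As [v] has squared norm [2 * (1 - s)], the factor [a] is 2 over that norm, as a reflection
   requires. *)
exists (1%:M - a *: (v *m dag v)); last first.
  rewrite mulmxBl mul1mx -scalemxAl -mulmxA ve mul_mx_scalar scalerA mulVf //.
  by rewrite scale1r /v opprB addrC subrK.
clearbody v; apply/unitaryP; rewrite dagB dag1 dagZ dagM dagK ar.
rewrite mulmxBl mul1mx mulmxBr mulmx1 -scalemxAl -scalemxAr.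
rewrite mulmxA -(mulmxA v) vv mul_mx_scalar -scalemxAl !scalerA.
rewrite (mulrCA a 2) mulVf // mulr1 mulr_natr mulr2n scalerDl.
by rewrite opprB addrK subrK.
Qed.

End Dagger.

(** * Classical maps and sign changes as operators on basis states *)

Section BasisOperators.
Context {R : realType} {B : finType}.
Notation C := R[i].
Notation e := (basis_vec R).

Lemma mx_basis p (M : 'M[C]_(p, #|B|)) (b : B) : M *m e b = col (enum_rank b) M.
Proof.
apply/matrixP => i j; rewrite !mxE (bigD1 (enum_rank b)) //= !mxE eqxx mulr1.
by rewrite big1 ?addr0 // => k /negbTE kb; rewrite mxE kb mulr0.
Qed.

Lemma basis_ortho (b c : B) : dag (e b) *m e c = (b == c)%:R%:M.
Proof.
apply/matrixP => i j; rewrite mx_basis !mxE !ord1 eqxx mulr1n rmorph_nat.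
by rewrite (inj_eq enum_rank_inj) eq_sym.
Qed.

Lemma basis_coord (psi : 'cV[C]_#|B|) (b : B) :
  dag (e b) *m psi = (psi (enum_rank b) 0)%:M.
Proof.
apply/matrixP => i j; rewrite !mxE !ord1 eqxx mulr1n (bigD1 (enum_rank b)) //=.
rewrite !mxE eqxx rmorph1 mul1r big1 ?addr0 // => k /negbTE kb.
by rewrite !mxE kb rmorph0 mul0r.
Qed.

(** Shaped like [oracle_mx], which is thus convertible to [map_basis (qshift x)]. *)
Definition map_basis (f : B -> B) : 'M[C]_#|B| :=
  \matrix_(r, c) (enum_val r == f (enum_val c))%:R.

Lemma map_basisE f b : map_basis f *m e b = e (f b).
Proof.
apply/matrixP => i j; rewrite mx_basis !mxE enum_rankK.
by congr (nat_of_bool _)%:R; apply/eqP/eqP => [<-|->]; rewrite ?enum_valK ?enum_rankK.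
Qed.

Lemma map_basis_mul f h : map_basis f *m map_basis h = map_basis (f \o h).
Proof.
apply/matrixP => i j; rewrite !mxE (bigD1 (enum_rank (h (enum_val j)))) //=.
rewrite !mxE enum_rankK eqxx mulr1 big1 ?addr0 // => k /negbTE kj.
by rewrite !mxE -[enum_val k == _](inj_eq enum_rank_inj) enum_valK kj mulr0.
Qed.

Lemma map_basis_sandwichE f k q b :
  map_basis f *m (map_basis k *m (map_basis q *m map_basis k)) *m e b = e (f (k (q (k b)))).
Proof. by rewrite !map_basis_mul map_basisE. Qed.

Lemma dag_map_basis f h : cancel f h -> cancel h f -> dag (map_basis f) = map_basis h.
Proof.
move=> fK hK; apply/matrixP => i j; rewrite !mxE rmorph_nat.
by congr (nat_of_bool _)%:R; apply/eqP/eqP => ->.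
Qed.

Lemma map_basis_unitary f h : cancel f h -> cancel h f -> unitary_mx (map_basis f).
Proof.
move=> fK hK; apply/unitaryP; rewrite (dag_map_basis fK hK) map_basis_mul.
apply/matrixP => i j; rewrite !mxE /= hK.
by rewrite (inj_eq enum_val_inj).
Qed.

Definition phase (s : B -> bool) : 'M[C]_#|B| :=
  diag_mx (\row_r (-1) ^+ s (enum_val r)).

Lemma phaseE s b : phase s *m e b = (-1) ^+ s b *: e b.
Proof.
apply/matrixP => i j; rewrite mul_diag_mx !mxE.
by case: eqVneq => [->|_]; rewrite ?enum_rankK ?mulr0.
Qed.

Lemma phase_unitary s : unitary_mx (phase s).
Proof.
apply/unitaryP; rewrite /dag map_diag_mx tr_diag_mx mulmx_diag.
apply/matrixP => i j; rewrite !mxE rmorph_sign.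
by rewrite -signr_addb addbb.
Qed.

End BasisOperators.

(** * Circuits with counted queries, their inverses and normal form *)

Section Circuits.
Context {R : realType} {I A : finType} {d : nat}.
Notation C := R[i].
Notation B := (qbasis I A d).
Notation op := 'M[C]_#|B|.
Notation O := (oracle_mx R d).

(** The index counts oracle calls, while input-independent unitaries are free. [circuit_ext] stands
    in for functional extensionality. *)
Inductive circuit : nat -> ({ffun I -> A} -> op) -> Prop :=
  | circuit_unitary U : unitary_mx U -> circuit 0 (fun _ => U)
  | circuit_query : circuit 1 O
  | circuit_comp s t L K : circuit s L -> circuit t K ->
      circuit (s + t) (fun x => K x *m L x)
  | circuit_ext t L K : circuit t L -> L =1 K -> circuit t K.

Lemma unitary_circuit t L : circuit t L -> forall x, unitary_mx (L x).
Proof.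
elim=> {t L} [U UU x||s t L K _ IHL _ IHK x|t L K _ IHL LK x] //.
(* The query index is preserved, so equal images come from adding the same answer modulo [#|A|]. *)
- move=> x; have inj : injective (@qshift I A d x).
    move=> [[i p] w] [[j q] v] [ij pq ->]; subst j.
    congr (_, _, _); apply: val_inj => /=.
    move/eqP: pq; rewrite eqn_modDr !modn_small // => /eqP.
    by [].
  have [h sK hK] := injF_bij inj.
  exact: map_basis_unitary sK hK.
- exact: unitary_mul.
- by rewrite -LK.
Qed.

(** The reduction modulo [N] matters at [p = 0], where [N - p] is [N]. *)
Definition oppord (N : nat) (p : 'I_N) : 'I_N :=
  Ordinal (ltn_pmod (N - p)%N (leq_ltn_trans (leq0n p) (ltn_ord p))).

Lemma oppordK N : involutive (@oppord N).
Proof.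
move=> p; apply: val_inj => /=; have pN := ltn_ord p.
case: (posnP p) => [->|p0]; first by rewrite subn0 modnn subn0 modnn.
by rewrite (@modn_small (N - p)) ?subKn ?modn_small //; lia.
Qed.

Lemma oppordD N (p q : 'I_N) : addord (oppord (addord p q)) q = oppord p.
Proof.
apply: val_inj => /=; have pN := ltn_ord p; have qN := ltn_ord q.
rewrite modnDml; have [pq|pq] := ltnP (p + q) N.
  by rewrite (@modn_small (p + q)) //; congr (_ %% _)%N; lia.
have -> : ((p + q) %% N = p + q - N)%N.
  by rewrite -[in LHS](subnK pq) modnDr modn_small //; lia.
by rewrite -(modnDr (N - p)%N N); congr (_ %% _)%N; lia.
Qed.

Definition negate_answer (b : B) : B := (b.1.1, oppord b.1.2, b.2).

Lemma negate_answerK : involutive negate_answer.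
Proof. by case=> [[i p] w]; rewrite /negate_answer /= oppordK. Qed.

(* Negating the answer register turns an oracle call into its inverse. *)
Lemma dag_oracle x :
  dag (O x) = map_basis negate_answer *m O x *m map_basis negate_answer.
Proof.
rewrite -[O x]/(map_basis (qshift x)) !map_basis_mul.
have sK : cancel (qshift x) (negate_answer \o qshift x \o negate_answer).
  by case=> [[i p] w]; rewrite /negate_answer /qshift /= oppordD oppordK.
apply: dag_map_basis => // b.
(* On a finite type the one-sided inverse is two-sided. *)
have inj := can_inj sK; have [h hK Kh] := injF_bij inj.
by rewrite -[in LHS](Kh b) sK Kh.
Qed.

(** An inverse oracle call costs one oracle call, so uncomputing is as cheap as computing. *)
Lemma circuit_dag t L : circuit t L -> circuit t (fun x => dag (L x)).
Proof.
elim=> {t L} [U UU||s t L K _ IHL _ IHK|t L K _ IHL LK].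
- exact/circuit_unitary/unitary_dag.
- have Nu : circuit 0 (fun _ => map_basis negate_answer).
    exact/circuit_unitary/(map_basis_unitary negate_answerK negate_answerK).
  apply: (circuit_ext (circuit_comp (circuit_comp Nu circuit_query) Nu)) => x.
  by rewrite dag_oracle mulmxA.
- rewrite addnC; apply: (circuit_ext (circuit_comp IHK IHL)) => x.
  by rewrite dagM.
- by apply: (circuit_ext IHL) => x; rewrite LK.
Qed.

Definition run (Us : seq op) (x : {ffun I -> A}) (psi : 'cV[C]_#|B|) :=
  foldl (fun s U => U *m (O x *m s)) psi Us.

(** The alternating form demanded by [QE_le]. A bare query is framed by identities; a composition
    fuses the last unitary of the first circuit with the initial one of the second. *)
Lemma circuit_run t L : circuit t L ->
  exists U0 Us, [/\ size Us = t, unitary_mx U0, all (@unitary_mx R _) Us &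
    forall x psi, run Us x (U0 *m psi) = L x *m psi].
Proof.
elim=> {t L} [U UU||s t L K _ [U0 [Us [sU U0u Uu UE]]] _ [V0 [Vs [sV V0u Vu VE]]]|].
- by exists U, [::].
- have id_u : unitary_mx (1%:M : op) by apply/unitaryP; rewrite dag1 mulmx1.
  exists 1%:M, [:: 1%:M]; split=> //=; first by rewrite id_u.
  by move=> x psi; rewrite !mul1mx.
(* If the first circuit makes no query, its last unitary is [U0]. *)
- case: (lastP Us) sU Uu UE => [|Us' W] sU Uu UE.
    exists (V0 *m U0), Vs; split=> [|||x psi]; rewrite -?sU ?unitary_mul //.
    by rewrite -mulmxA VE -mulmxA -UE.
  exists U0, (Us' ++ (V0 *m W) :: Vs); split=> [|||x psi].
  + by rewrite size_cat /= addnS -addSn -(size_rcons Us' W) sU sV.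
  + exact: U0u.
  + move: Uu; rewrite all_rcons => /andP[Wu U'u].
    by rewrite all_cat U'u /= Vu unitary_mul.
  + rewrite /run foldl_cat /= -(mulmxA V0) -/(run Vs x _) VE -mulmxA -UE.
    by rewrite /run foldl_rcons.
- move=> t L K _ [U0 [Us [sU U0u Uu UE]]] LK; exists U0, Us; split=> // x psi.
  by rewrite UE LK.
Qed.

End Circuits.

(** * Stepwise traversal of a decision tree *)

Section Traversal.
Context {I : finType} {A : Type}.
Variable i0 : I.
Implicit Types (D : dtree I A) (x : I -> A).

(** A leaf issues a dummy query to [i0], so that all branches can run for the same number of
    steps. *)
Definition next_query D : I := if D is DQuery i _ then i else i0.

Definition subtree D (v : A) : dtree I A := if D is DQuery _ k then k v else D.

Definition leaf_value D : bool := if D is DLeaf b then b else false.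

Fixpoint descend D x (t : nat) : dtree I A :=
  if t is t'.+1 then subtree (descend D x t') (x (next_query (descend D x t')))
  else D.

Lemma leaf_value_descend D x t :
  (dt_cost D x <= t)%N -> leaf_value (descend D x t) = dt_eval D x.
Proof.
move=> Dt.
(* Each step lowers the remaining cost by one, down to 0, and preserves the value; cost 0 means a
   leaf. *)
have [cE ->] : dt_cost (descend D x t) x = (dt_cost D x - t)%N /\
    dt_eval D x = dt_eval (descend D x t) x.
  elim: t {Dt} => [|t [IHc IHe]] /=; first by rewrite subn0.
  by rewrite subnS -IHc IHe; case: (descend D x t).
have: dt_cost (descend D x t) x = 0%N by rewrite cE; apply/eqP.
by case: (descend D x t).
Qed.

End Traversal.

(** * Reversible simulation of decision trees *)

Section CoherentSimulation.
Context {R : realType} {I A J : finType}.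
Variables (i0 : I) (a0 : A) (D : J -> dtree I A) (T : nat).

Notation answer := 'I_#|A|.
(** Keeping every answer makes the traversal reversible; there is one slot for each of [T.+1]
    steps. *)
Definition history : finType := {ffun 'I_T.+1 -> answer}.
Notation work := (J * history)%type.
Notation B := (qbasis I A #|{: work}|).
Notation e := (basis_vec R).
Implicit Types (x : {ffun I -> A}) (h : history) (b : B).

Lemma zero_answer_subproof : (0 < #|A|)%N.
Proof. by apply/card_gt0P; exists a0. Qed.

Definition zero_answer : answer := Ordinal zero_answer_subproof.

Fixpoint replay (E : dtree I A) h (t : nat) : dtree I A :=
  if t is t'.+1 then subtree (replay E h t') (enum_val (h (inord t'))) else E.

(** A transposition is its own inverse: applied before the oracle call it loads the query, applied
    afterwards it restores [i0]. *)
Definition swap_query (t : nat) b : B :=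
  let w : work := enum_val b.2 in
  (tperm i0 (next_query i0 (replay (D w.1) w.2 t)) b.1.1, b.1.2, b.2).

Definition swap_answer (t : 'I_T.+1) b : B :=
  let w : work := enum_val b.2 in
  (b.1.1, w.2 t,
   enum_rank ((w.1, [ffun s => if s == t then b.1.2 else w.2 s]) : work)).

Lemma swap_queryK t : involutive (swap_query t).
Proof. by case=> [[i p] w]; rewrite /swap_query /= tpermK. Qed.

Lemma swap_answerK t : involutive (swap_answer t).
Proof.
case=> [[i p] w]; rewrite /swap_answer /= !enum_rankK /= ffunE eqxx.
congr (_, _, _); rewrite -[RHS]enum_valK; congr (enum_rank _).
case: (enum_val w) => j h /=; congr (_, _); apply/ffunP => s.
by rewrite !ffunE; case: eqVneq => [->|].
Qed.

Definition recorded x j (t : nat) : history :=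
  [ffun s : 'I_T.+1 => if (s < t)%N then
     enum_rank (x (next_query i0 (descend i0 (D j) x s))) else zero_answer].

Definition snapshot x j (t : nat) : B :=
  (i0, zero_answer, enum_rank ((j, recorded x j t) : work)).

Definition start j : B :=
  (i0, zero_answer, enum_rank ((j, [ffun=> zero_answer]) : work)).

Lemma snapshot0 x j : snapshot x j 0 = start j.
Proof.
by rewrite /snapshot (_ : recorded x j 0 = [ffun=> zero_answer]) //; apply/ffunP => s; rewrite !ffunE.
Qed.

(** Step [t] depends only on the first [t] slots; the bound [t <= T.+1] keeps [inord] faithful. *)
Lemma replay_recorded x j t t' : (t <= t')%N -> (t <= T.+1)%N ->
  replay (D j) (recorded x j t') t = descend i0 (D j) x t.
Proof.
move=> tt' tT; elim: t tt' tT => //= t IH tt' tT.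
by rewrite IH ?(ltnW tt') ?(ltnW tT) // ffunE inordK // tt' enum_rankK.
Qed.

Definition sim_step (t : 'I_T.+1) x : 'M[R[i]]_#|B| :=
  map_basis (swap_answer t) *m (map_basis (swap_query t) *m
    (oracle_mx R _ x *m map_basis (swap_query t))).

Lemma circuit_sim_step t : circuit 1 (sim_step t).
Proof.
have sq : circuit 0 (fun _ : {ffun I -> A} => map_basis (swap_query t) : 'M[R[i]]_#|B|).
  by apply: circuit_unitary; exact: map_basis_unitary (swap_queryK t) (swap_queryK t).
have sa : circuit 0 (fun _ : {ffun I -> A} => map_basis (swap_answer t) : 'M[R[i]]_#|B|).
  by apply: circuit_unitary; exact: map_basis_unitary (swap_answerK t) (swap_answerK t).
exact: circuit_comp (circuit_comp (circuit_comp sq circuit_query) sq) sa.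
Qed.

Lemma sim_stepE (t : 'I_T.+1) x j :
  sim_step t x *m e (snapshot x j t) = e (snapshot x j t.+1).
Proof.
rewrite (map_basis_sandwichE _ (swap_query t) (qshift x)); congr (e _).
have rE := replay_recorded x j (leqnn t) (ltnW (ltn_ord t)).
rewrite /snapshot /swap_query /= !enum_rankK /= rE tpermL.
(* Slot [t] still holds zero, so the swap clears the answer register. *)
rewrite tpermR /swap_answer /= enum_rankK /= ffunE ltnn.
congr (_, _, enum_rank (_, _)); apply/ffunP => s; rewrite !ffunE ltnS [(s <= t)%N]leq_eqVlt.
case: eqVneq => [->|st] /=; last by rewrite (negbTE (_ : s != t :> nat)).
by rewrite eqxx; apply: val_inj; rewrite /= add0n modn_small.
Qed.

Lemma circuit_sim (t : nat) : (t <= T.+1)%N -> exists2 L, circuit t L &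
  forall x j, L x *m e (start j) = e (snapshot x j t).
Proof.
elim: t => [_|t IH tT].
  exists (fun _ => 1%:M); first by apply/circuit_unitary/unitaryP; rewrite dag1 mulmx1.
  by move=> x j; rewrite mul1mx snapshot0.
have [L cL LE] := IH (ltnW tT).
exists (fun x => sim_step (Ordinal tT) x *m L x).
  by rewrite -addn1; apply: circuit_comp cL (circuit_sim_step _).
by move=> x j; rewrite -mulmxA LE (sim_stepE (Ordinal tT)).
Qed.

(** Compute, sign, uncompute: the recorded history would block interference between different [j],
    so it is erased, which doubles the query count. *)
Lemma circuit_phase :
  (forall x j, (dt_cost (D j) x <= T.+1)%N) ->
  exists2 L, circuit (T.+1).*2 L &
    forall x j, L x *m e (start j) = (-1) ^+ dt_eval (D j) x *: e (start j).
Proof.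
move=> cost; have [L cL LE] := circuit_sim (leqnn T.+1).
pose s b := let w : work := enum_val b.2 in leaf_value (replay (D w.1) w.2 T.+1).
exists (fun x => dag (L x) *m (phase s *m L x)).
  rewrite -addnn -[X in (X + _)%N]addn0.
  apply: circuit_comp (circuit_dag cL).
  exact: circuit_comp cL (circuit_unitary (phase_unitary _)).
move=> x j; rewrite -!mulmxA LE phaseE -scalemxAr -LE mulmxA.
rewrite (unitary_dagl (unitary_circuit cL x)) mul1mx; congr (_ ^+ _ *: _).
by rewrite /s /snapshot enum_rankK replay_recorded // leaf_value_descend.
Qed.

End CoherentSimulation.

(** * Measurement and the Deutsch-Jozsa algorithm *)

Lemma out_prob_neq (R : realType) (B : finType) (psi : 'cV[R[i]]_#|B|) (b0 : B) :
  dag psi *m psi = 1%:M ->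
  let p0 := psi (enum_rank b0) 0 * conjc (psi (enum_rank b0) 0) in
  out_prob psi (fun b => b != b0) false = p0 /\
  out_prob psi (fun b => b != b0) true = 1 - p0.
Proof.
move=> psi1 p0.
have out0 : out_prob psi (fun b => b != b0) false = p0.
  rewrite /out_prob (big_pred1 (enum_rank b0)) // => r /=.
  by rewrite eqbF_neg negbK -(inj_eq enum_rank_inj) enum_valK.
split=> //; rewrite -out0 /out_prob; apply/eqP; rewrite eq_sym subr_eq eq_sym; apply/eqP.
have -> : 1 = \sum_r psi r 0 * conjc (psi r 0).
  have /(congr1 (fun M : 'M_1 => M 0 0)) := psi1.
  rewrite !mxE eqxx mulr1n => <-; apply: eq_bigr => r _.
  by rewrite !mxE mulrC.
rewrite [RHS](bigID (fun r => enum_val r != b0)) /=.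
by congr (_ + _); apply: eq_bigl => r; rewrite ?eqb_id ?eqbF_neg.
Qed.

Section DeutschJozsa.
Context {R : realType} {J B : finType}.
Notation e := (basis_vec R).
Variable start : J -> B.
Hypothesis start_inj : injective start.

Let s : R[i] := (Num.sqrt (#|J|%:R^-1 : R))%:C%C.

Let s2 : (0 < #|J|)%N -> s * s = #|J|%:R^-1.
Proof.
by rewrite -rmorphM -expr2 sqr_sqrtr ?invr_ge0 ?ler0n // fmorphV rmorph_nat.
Qed.

Definition uniform : 'cV[R[i]]_#|B| := s *: \sum_j e (start j).

Let conj_s : conjc s = s.
Proof. by rewrite /s conjc_real. Qed.

Lemma basis_uniform j : dag (e (start j)) *m uniform = s%:M.
Proof.
rewrite /uniform -scalemxAr mulmx_sumr (bigD1 j) //= basis_ortho eqxx.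
rewrite big1 ?addr0 ?scale_scalar_mx ?mulr1 // => k kj.
by rewrite basis_ortho (inj_eq start_inj) eq_sym (negbTE kj) raddf0.
Qed.

Lemma uniform_basis j : dag uniform *m e (start j) = s%:M.
Proof.
rewrite -[LHS]dagK dagM dagK basis_uniform; apply/matrixP => k l.
by rewrite !mxE !ord1 eqxx mulr1n conj_s.
Qed.

(* Interference: only the average of the signs survives at the initial state. *)
Lemma uniform_signs (L : 'M[R[i]]_#|B|) (b : J -> bool) :
  (0 < #|J|)%N ->
  (forall j, L *m e (start j) = (-1) ^+ b j *: e (start j)) ->
  dag uniform *m (L *m uniform) = (#|J|%:R^-1 * \sum_j (-1) ^+ b j)%:M.
Proof.
move=> J0 LE.
have -> : L *m uniform = s *: \sum_j (-1) ^+ b j *: e (start j).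
  by rewrite -scalemxAr mulmx_sumr; congr (_ *: _); apply: eq_bigr => j _.
rewrite -scalemxAr mulmx_sumr -s2 // -mulrA mulr_sumr -scale_scalar_mx.
congr (_ *: _); rewrite raddf_sum; apply: eq_bigr => j _.
by rewrite -scalemxAr uniform_basis scale_scalar_mx mulrC.
Qed.

(** The interference formula for the identity with all signs positive. *)
Lemma uniform_unit : (0 < #|J|)%N -> dag uniform *m uniform = 1%:M.
Proof.
move=> J0; have := @uniform_signs 1%:M (fun _ => false) J0.
rewrite mul1mx => ->; last by move=> j; rewrite mul1mx scale1r.
by rewrite sumr_const mulVf // pnatr_eq0 -lt0n.
Qed.

Lemma prepare_uniform j : (1 < #|J|)%N ->
  exists2 V : 'M[R[i]]_#|B|, unitary_mx V & V *m e (start j) = uniform.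
Proof.
move=> J1; have J0 := ltnW J1.
apply: (unitary_transport _ (uniform_unit J0) (basis_uniform j) (uniform_basis j) conj_s).
  by rewrite basis_ortho eqxx.
(* The amplitude [s] could be 1 only for a single index, which [1 < #|J|] excludes. *)
apply/negP => /eqP s1; have /eqP := s2 J0.
by rewrite s1 mulr1 eq_sym invr_eq1 pnatr_eq1 gtn_eqF.
Qed.

End DeutschJozsa.

Lemma sum_signs (R : pzRingType) (J : finType) (b : J -> bool) :
  \sum_j (-1) ^+ b j = #|J|%:R - #|[set j | b j]|.*2%:R :> R.
Proof.
have -> : (#|[set j | b j]|.*2 = \sum_j (b j).*2)%N.
  rewrite -muln2 -sum1dep_card big_distrl big_mkcond /=.
  by apply: eq_bigr => j _; case: (b j).
rewrite natr_sum -sumr_const -sumrB.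
by apply: eq_bigr => j _; case: (b j); rewrite ?subr0 // expr1 -addnn natrD opprD addNKr.
Qed.

(** On a 0-input all signs agree and the state returns to [b0]; on a 1-input the signs cancel and
    the amplitude at [b0] vanishes. The output tells whether [b0] has been left. *)
Lemma QE_le_balanced (R : realType) (I A J : finType) (i0 : I) (a0 : A)
    (f : {ffun I -> A} -> bool) (D : J -> dtree I A) (T : nat) :
  (1 < #|J|)%N ->
  (forall x j, f x = false -> dt_eval (D j) x = false) ->
  (forall x : {ffun I -> A}, f x -> (#|[set j | dt_eval (D j) x]|.*2 = #|J|)%N) ->
  (forall (x : {ffun I -> A}) j, (dt_cost (D j) x <= T.+1)%N) ->
  QE_le R f T.+1.*2.
Proof.
move=> J1 rej bal cost; have J0 := ltnW J1.
have [L cL LE] := circuit_phase (R := R) i0 a0 cost.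
have start_inj : injective (start i0 a0 T : J -> _).
  by move=> j k [] /enum_rank_inj [].
have [j0 _] := card_gt0P J0; set b0 := start i0 a0 T j0.
have [V Vu VE] := prepare_uniform (R := R) start_inj j0 J1.
have cV : circuit T.+1.*2 (fun x => dag V *m (L x *m V)).
  rewrite -[T.+1.*2]addn0 -[X in (X + _)%N]add0n.
  apply: circuit_comp (circuit_unitary (unitary_dag Vu)).
  exact: circuit_comp (circuit_unitary Vu) cL.
have [U0 [Us [sU U0u Uu UE]]] := circuit_run cV.
exists _, b0, U0, Us, (fun b => b != b0); split; first by [].
split=> [|x]; first by rewrite /= U0u.
rewrite -[final_state _ _ _ _]/(run Us x (U0 *m basis_vec R b0)) UE.
set psi := _ *m basis_vec R b0.
have psi1 : dag psi *m psi = 1%:M.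
  rewrite /psi dagM -mulmxA (mulmxA (dag _) _ (basis_vec R b0)).
  by rewrite (unitary_dagl (unitary_circuit cV x)) mul1mx basis_ortho eqxx.
have amp : psi (enum_rank b0) 0
    = #|J|%:R^-1 * (#|J|%:R - #|[set j | dt_eval (D j) x]|.*2%:R).
  have := basis_coord psi b0.
  (* Moving [V] to the left factor turns the amplitude at [b0] into an overlap with the uniform
     state. *)
  have -> : dag (basis_vec R b0) *m psi
      = dag (uniform (start i0 a0 T)) *m (L x *m uniform (start i0 a0 T)).
    by rewrite /psi -VE dagM -!mulmxA.
  rewrite (uniform_signs start_inj J0 (LE x)) sum_signs.
  by move=> /(congr1 (fun M : 'M_1 => M 0 0)); rewrite !mxE eqxx !mulr1n => <-.
have Jn0 : #|J|%:R != 0 :> R[i] by rewrite pnatr_eq0 -lt0n.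
have [out0 out1] := out_prob_neq b0 psi1.
case fx: (f x); rewrite ?out0 ?out1 amp.
  by rewrite bal // subrr mulr0 mul0r subr0.
rewrite (_ : [set j | _] = set0) ?cards0; last first.
  by apply/setP => j; rewrite !inE rej.
by rewrite subr0 mulVf // rmorph1 mulr1.
Qed.
Theorem theorem12 (R : realType) :
  (exists C k : nat, forall n m : nat, (0 < n)%N -> (0 < m)%N -> ~~ odd m ->
     R1_le (g n m) ((ot_bound C k n m)%:R : R)) /\
  (exists C k : nat, forall n m : nat, (0 < n)%N -> (0 < m)%N -> ~~ odd m ->
     QE_le R (g n m) (ot_bound C k n m)).
Proof.
split.
  exists 4%N, 1%N => n m _ m0 em; rewrite /ot_bound expn1.
  apply: (@R1_le_uniform _ _ _ _ _ (fun j : 'I_m => dtree_of (column_test j))).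
  - by rewrite card_ord.
  - exact: column_test_reject.
  - by move=> x gx; rewrite card_ord column_test_balanced.
  - by move=> x j; rewrite dt_cost_of pcost_column_test.
(* Twice the classical constant 4, for computing and uncomputing the test. *)
exists 8%N, 1%N => n m n0 m0 em.
set T := (4 * (n + m) * (trunc_log 2 (n + m)).+1)%N.
have T0 : (0 < T)%N by rewrite !muln_gt0 addn_gt0 n0.
have -> : ot_bound 8 1 n m = T.-1.+1.*2.
  by rewrite prednK // /ot_bound expn1 -mul2n !mulnA.
apply: (@QE_le_balanced _ _ _ _ (Ordinal n0, Ordinal m0) blank _
  (fun j : 'I_m => dtree_of (column_test j))).
(* A positive even [m] is at least 2. *)
- by rewrite card_ord; case: m m0 em {T T0} => [|[]].
- exact: column_test_reject.
- by move=> x gx; rewrite card_ord column_test_balanced.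
- by move=> x j; rewrite prednK // dt_cost_of pcost_column_test.
Qed.
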